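(* Let $m\geq 4$ be an integer. The set $A=\left\{\sum_{n\in\omega}\frac{i_n}{m^{n+1}}:\ i_n\in\{0,m-1\}\text{ for all }n\in\omega\right\}\subseteq\mathbb{R}$ is Haar-$1$.
   Context: $\omega=\{0,1,2,\ldots\}$. A subset $A$ of $\mathbb{R}$ is Haar-$1$ if there are a Borel set $B\subseteq\mathbb{R}$ with $A\subseteq B$ and a homeomorphic copy $C\subseteq\mathbb{R}$ of $2^\omega$ such that $|(C+x)\cap B|\leq 1$ for all $x\in\mathbb{R}$. *)

(* Defs.v *)
From mathcomp Require Import all_boot all_order all_algebra.
From mathcomp Require Import all_classical all_reals all_analysis.
Import Order.TTheory GRing.Theory Num.Theory.
Import numFieldNormedType.Exports.

Set Implicit Arguments.
Unset Strict Implicit.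
Unset Printing Implicit Defensive.

Local Open Scope classical_set_scope.
Local Open Scope ring_scope.

Definition homeomorphic_copy (S T : topologicalType) (C : set T) : Prop :=
  exists (f : S -> T) (g : T -> S),
    [/\ continuous f, range f = C, cancel f g & {within C, continuous g}].

(* [measurable] on a [realType] means Borel: the sigma-algebra is generated by
   the intervals ]a, b], equivalently by the open intervals
   ([measurable_realfun.RGenOpens.measurableE]). *)
Definition Haar1 (R : realType) (A : set R) : Prop :=
  exists B C : set R,
    [/\ measurable B, A `<=` B, homeomorphic_copy cantor_space C &
        forall x : R, ([set c + x | c in C] `&` B #<= `I_1)%card].

(* Main.v *)
(* Up to the factor (m - 1) / m, the set A is the compact set of all sums
   \sum_n a_n m^-n with a_n in {0, 1}.  With the same scaling, take C to be
   the set of all sums 2 \sum_n b_n m^(-2n) with b_n in {0, 1}.  If two points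
   of a translate of C lie in A, then 2 \sum_n d_n m^(-2n) = \sum_n e_n m^-n
   with all d_n and e_n in {-1, 0, 1}.  Comparing leading digits,
   |2 d_0 - e_0| <= 2 / (m^2 - 1) + 1 / (m - 1) < 1, so d_0 = e_0 = 0;
   multiplying by m^2 and iterating (now modulo m, because of the digit e_1)
   gives d = 0, hence the two points coincide. *)
Require Import Defs.
From mathcomp Require Import all_boot all_order all_algebra.
From mathcomp Require Import all_classical all_reals all_analysis.
From mathcomp Require Import zify ring lra.
Import Order.TTheory GRing.Theory Num.Theory.
Import numFieldNormedType.Exports.

Local Open Scope classical_set_scope.
Local Open Scope ring_scope.

(** Digits are arbitrary reals, so differences of two 0-1 expansions are covered as well. The value
    is meaningful only when the series converges, which [0 <= q < 1] and [|d n| <= 1] guarantee. *)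
Definition digit_sum {R : realType} (q : R) (d : nat -> R) : R :=
  limn (series (fun n => d n * q ^+ n)).

Lemma is_cvg_norm_digit_series (R : realType) (q : R) (d : nat -> R) :
  0 <= q < 1 -> (forall n, `|d n| <= 1) ->
  cvgn [normed series (fun n => d n * q ^+ n)].
Proof.
move=> /andP[q0 q1] d1; apply: (@series_le_cvg _ _ (geometric 1 q)) => [n|n|n|].
- exact: normr_ge0.
- by rewrite /= mul1r exprn_ge0.
- by rewrite /= normrM (ger0_norm (exprn_ge0 _ q0)) ler_wpM2r ?exprn_ge0.
- by apply: is_cvg_geometric_series; rewrite ger0_norm.
Qed.

Lemma cvg_digit_sum (R : realType) (q : R) (d : nat -> R) :
  0 <= q < 1 -> (forall n, `|d n| <= 1) ->
  series (fun n => d n * q ^+ n) @ \oo --> digit_sum q d.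
Proof. by move=> q01 d1; apply: normed_cvg; exact: is_cvg_norm_digit_series. Qed.

Lemma norm_digit_sum (R : realType) (q : R) (d : nat -> R) :
  0 <= q < 1 -> (forall n, `|d n| <= 1) -> `|digit_sum q d| <= (1 - q)^-1.
Proof.
move=> /[dup] q01 /andP[q0 q1] d1.
apply: le_trans (lim_series_norm (is_cvg_norm_digit_series _ _ _ q01 d1)) _.
have qn : `|q| < 1 by rewrite ger0_norm.
have gE : limn (series (geometric 1 q)) = (1 - q)^-1.
  by rewrite -[RHS]mul1r; apply: cvg_lim => //; exact: cvg_geometric_series.
rewrite -gE; apply: lim_series_le => [||n].
- exact: is_cvg_norm_digit_series.
- exact: is_cvg_geometric_series.
- by rewrite /= normrM (ger0_norm (exprn_ge0 _ q0)) ler_wpM2r ?exprn_ge0.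
Qed.

Lemma digit_sumB (R : realType) (q : R) (d e : nat -> R) :
  0 <= q < 1 -> (forall n, `|d n| <= 1) -> (forall n, `|e n| <= 1) ->
  digit_sum q (fun n => d n - e n) = digit_sum q d - digit_sum q e.
Proof.
move=> q01 d1 e1; rewrite /digit_sum -lim_seriesB.
- by congr (limn (series _)); apply/funext => n /=; rewrite mulrBl.
- exact: cvgP (cvg_digit_sum _ _ _ q01 d1).
- exact: cvgP (cvg_digit_sum _ _ _ q01 e1).
Qed.

Lemma digit_sum_recl (R : realType) (q : R) (d : nat -> R) :
  0 <= q < 1 -> (forall n, `|d n| <= 1) ->
  digit_sum q d = d 0%N + q * digit_sum q (fun n => d n.+1).
Proof.
move=> q01 d1; apply: cvg_lim => //; rewrite -cvg_shiftS.
have -> : [sequence series (fun n => d n * q ^+ n) n.+1]_n =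
    (fun n => d 0%N + q * series (fun n => d n.+1 * q ^+ n) n).
  apply/funext => n; rewrite /series /= big_nat_recl// expr0 mulr1 mulr_sumr.
  by congr (_ + _); apply: eq_bigr => i _; rewrite exprS mulrCA.
apply: cvgD; first exact: cvg_cst.
by apply: cvgMr; apply: cvg_digit_sum.
Qed.

(** Applied to the difference of two digit sequences that agree below [K], this gives the modulus of
    continuity of the digit sum. *)
Lemma norm_digit_sum_tail (R : realType) (q : R) (d : nat -> R) (K : nat) :
  0 <= q < 1 -> (forall n, `|d n| <= 1) -> (forall n, (n < K)%N -> d n = 0) ->
  `|digit_sum q d| <= q ^+ K * (1 - q)^-1.
Proof.
move=> q01; elim: K d => [|K IH] d d1 dK.
  by rewrite expr0 mul1r; exact: norm_digit_sum.
have /andP[q0 _] := q01.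
rewrite digit_sum_recl// dK// add0r normrM ger0_norm// exprS -mulrA.
by rewrite ler_wpM2l// IH// => n nK; rewrite dK.
Qed.

(** An integer of absolute value below 1 vanishes, so [m * k = 2 * d - e]. As
    [|2 * d - e| <= 3 < m], [k] is 0; then [e = 2 * d] is even, hence 0. *)
Lemma double_digit_eq0 (m : nat) (d e k : int) :
  (4 <= m)%N -> `|d| <= 1 -> `|e| <= 1 -> `|2 * d - e - m%:Z * k| < 1 ->
  [/\ d = 0, e = 0 & k = 0].
Proof.
move=> m4 d1 e1 dek.
have mk : m%:Z * k = 2 * d - e by lia.
have k0 : k = 0 by nia.
by split=> //; rewrite k0 mulr0 in mk; lia.
Qed.

(* The term [m * k] is the digit [e 1] carried over from the previous step. *)
Lemma double_digit_sum_step (R : realType) (m : nat) (d e : nat -> int)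
    (k : int) :
  (4 <= m)%N -> (forall n, `|d n| <= 1) -> (forall n, `|e n| <= 1) ->
  2 * digit_sum (m%:R^-1 ^+ 2) (fun n => (d n)%:~R) =
    digit_sum m%:R^-1 (fun n => (e n)%:~R) + (m%:Z * k)%:~R :> R ->
  d 0%N = 0 /\
  2 * digit_sum (m%:R^-1 ^+ 2) (fun n => (d n.+1)%:~R) =
    digit_sum m%:R^-1 (fun n => (e n.+2)%:~R) + (m%:Z * e 1%N)%:~R :> R.
Proof.
move=> m4 d1 e1; set q := m%:R^-1.
have m0 : 0 < m%:R :> R by rewrite ltr0n; lia.
have mq : m%:R * q = 1 by rewrite mulfV// gt_eqF.
have q0 : 0 < q by rewrite invr_gt0.
have q14 : q <= 4^-1 by rewrite lef_pV2 ?posrE// ler_nat.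
have q01 : 0 <= q < 1 by apply/andP; split; lra.
have Q16 : q ^+ 2 <= 16^-1 by nra.
have Q01 : 0 <= q ^+ 2 < 1 by apply/andP; split; nra.
have dR1 n : `|(d n)%:~R| <= 1 :> R by rewrite -intr_norm -[leRHS]/(1%:~R) ler_int.
have eR1 n : `|(e n)%:~R| <= 1 :> R by rewrite -intr_norm -[leRHS]/(1%:~R) ler_int.
rewrite (digit_sum_recl _ _ _ Q01 dR1) (digit_sum_recl _ _ _ q01 eR1).
set x := digit_sum (q ^+ 2) _; set y := digit_sum q _ => H.
have x1 : `|x| <= 16 / 15.
  apply: (le_trans (norm_digit_sum _ _ _ Q01 _)) => //.
  rewrite -[leRHS]invrK lef_pV2 ?posrE; lra.
have y1 : `|y| <= 4 / 3.
  apply: (le_trans (norm_digit_sum _ _ _ q01 _)) => //.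
  rewrite -[leRHS]invrK lef_pV2 ?posrE; lra.
have [d00 e00 k0] : [/\ d 0%N = 0, e 0%N = 0 & k = 0].
  apply: (double_digit_eq0 m) => //.
  rewrite -(ltr_int R) intr_norm.
  (* The right-hand side is at most 1/4 * 4/3 + 2 * 1/16 * 16/15 = 7/15 in absolute value. *)
  have -> : (2 * d 0%N - e 0%N - m%:Z * k)%:~R = q * y - 2 * (q ^+ 2 * x) :> R.
    rewrite !intrB [(2 * _)%:~R]intrM; lra.
  move: x1 y1; rewrite !ler_norml ltr_norml => /andP[? ?] /andP[? ?].
  apply/andP; split; nra.
split=> //; move: H.
rewrite d00 e00 k0 mulr0 !add0r addr0 => H.
(* Now [H] reads [2 * (q ^+ 2 * x) = q * y]; cancel [q ^+ 2]. Splitting [e 1] off [y] then produces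
   the new integer term. *)
have -> : 2 * x = m%:R * y.
  apply: (mulfI (lt0r_neq0 q0)); apply: (mulfI (lt0r_neq0 q0)).
  rewrite [q * (m%:R * _)]mulrA [q * m%:R]mulrC mq; nra.
rewrite /y digit_sum_recl// mulrDr mulrA mq mul1r addrC.
by rewrite intrM.
Qed.

(** The integer [k] is kept general for the induction on [n]: each step shifts [d] by one place and
    [e] by two, and puts [e 1] in place of [k]. *)
Lemma double_digit_sum_eq0 (R : realType) (m : nat) (d e : nat -> int)
    (k : int) :
  (4 <= m)%N -> (forall n, `|d n| <= 1) -> (forall n, `|e n| <= 1) ->
  2 * digit_sum (m%:R^-1 ^+ 2) (fun n => (d n)%:~R) =
    digit_sum m%:R^-1 (fun n => (e n)%:~R) + (m%:Z * k)%:~R :> R ->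
  forall n, d n = 0.
Proof.
move=> m4 d1 e1 H n; elim: n d e k d1 e1 H => [|n IH] d e k d1 e1.
  by move=> /(double_digit_sum_step _ _ _ _ _ m4 d1 e1)[].
move=> /(double_digit_sum_step _ _ _ _ _ m4 d1 e1)[_].
exact: (IH (fun n => d n.+1) (fun n => e n.+2)).
Qed.

Lemma near_cantor_prefix (b : cantor_space) (K : nat) :
  \forall b' \near b, forall n, (n < K)%N -> b' n = b n.
Proof.
elim: K => [|K IH]; first by near=> b'.
have bK : \forall b' \near b, b' K = b K.
  (* Singletons of [bool] are open, so each coordinate is locally constant. *)
  exact: (@proj_continuous _ (fun=> bool) K b _ (discrete_set1 (b K))).
near=> b' => n; rewrite ltnS leq_eqVlt => /orP[/eqP ->|].
  by near: b'.
by move: n; near: b'.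
Unshelve. all: by end_near. Qed.

Lemma continuous_digit_sum (R : realType) (q : R) :
  0 <= q < 1 ->
  continuous (fun b : cantor_space => digit_sum q (fun n => (b n)%:R)).
Proof.
move=> /[dup] q01 /andP[q0 q1] b; apply/cvgrPdist_lt => e e0.
have bool1 (c : bool) : `|c%:R| <= 1 :> R by case: c; rewrite ?normr1 ?normr0.
(* Choose a prefix length [K] with [q ^+ K / (1 - q) < e], the bound for sequences agreeing below
   [K]. *)
have [K _ /(_ K (leqnn K)) /=] :
    \forall n \near \oo, `|0 - geometric (1 - q)^-1 q n| < e.
  have qn : `|q| < 1 by rewrite ger0_norm.
  by have /cvgrPdist_lt/(_ e e0) := cvg_geometric (1 - q)^-1 qn.
rewrite sub0r normrN ger0_norm; last first.
  by rewrite mulr_ge0 ?exprn_ge0// invr_ge0 subr_ge0 ltW.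
move=> Ke; near=> b'; rewrite -digit_sumB//.
apply: le_lt_trans Ke; rewrite mulrC norm_digit_sum_tail// => n.
  by case: (b n); case: (b' n); rewrite ?subrr ?subr0 ?sub0r ?normrN ?normr1 ?normr0.
move=> nK; suff -> : b' n = b n by rewrite subrr.
by move: n nK; near: b'; exact: near_cantor_prefix.
Unshelve. all: by end_near. Qed.

(** Closed subsets of [S] are compact, so their images under [f] are compact and hence closed in
    [T]: the inverse is continuous on the range. Off the range, [g] takes the default value
    [point]. *)
Lemma compact_homeomorphic_copy (S : ptopologicalType) (T : topologicalType)
    (f : S -> T) :
  compact [set: S] -> hausdorff_space T -> continuous f -> injective f ->
  homeomorphic_copy S (range f).
Proof.
move=> cS hT cf f_inj; pose g y := xget point [set x | f x = y].
have fK : cancel f g.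
  move=> x; apply: f_inj.
  exact: (@xgetPex _ point [set x' | f x' = f x]) (ex_intro _ x erefl).
exists f, g; split => //.
apply/continuous_closedP => A cA; apply/closed_subspaceP.
(* On the range of [f], the preimage of [A] under [g] is the image of [A] under [f]. *)
exists (f @` A).
  apply: compact_closed => //; apply: continuous_compact.
    exact: continuous_subspaceT.
  exact: subclosed_compact cA cS _.
apply/seteqP; split=> y /=.
  by move=> [[a Aa <-] [b _ _]]; split; [change (A (g (f a))); rewrite fK | exists a].
case=> Agy [b _ yE]; split; exists b => //.
by rewrite -[b]fK yE.
Qed.

Lemma is_subset1_card_le (T : Type) (A : set T) :
  is_subset1 A -> (A #<= `I_1)%card.
Proof.
move=> A1; have [->|/set0P[x Ax]] := eqVneq A set0; first exact: card_ge0.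
rewrite -(card_le_eqr (@card_set1 T x)).
by apply: subset_card_le => y Ay; exact: A1.
Qed.

Theorem corollary3p3 (R : realType) (m : nat) (hm : (4 <= m)%N) :
  Haar1 [set a : R | exists2 i : nat -> nat,
    (forall n, i n = 0%N \/ i n = (m - 1)%N) &
    series (fun n => (i n)%:R / m%:R ^+ n.+1 : R) @ \oo --> a].
Proof.
set A := [set a | _]; pose q : R := m%:R^-1.
pose c : R := (m - 1)%:R * q.
have q0 : 0 < q by rewrite invr_gt0 ltr0n; lia.
have q01 : 0 <= q < 1.
  by rewrite ltW//= invf_lt1 ?ltr0n ?ltr1n//; lia.
have Q01 : 0 <= q ^+ 2 < 1.
  by case/andP: q01 => ? ?; apply/andP; split; nra.
have c0 : c != 0 by rewrite mulf_neq0 ?gt_eqF// ltr0n; lia.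
have bool1 (b : bool) : `|b%:R| <= 1 :> R by case: b; rewrite ?normr1 ?normr0.
pose fA (b : cantor_space) := c * digit_sum q (fun n => (b n)%:R).
pose fC (b : cantor_space) :=
  c * (2 * digit_sum (q ^+ 2) (fun n => (b n)%:R)).
have fAc : continuous fA.
  by move=> b; apply: cvgMr; exact: continuous_digit_sum.
have fCc : continuous fC.
  by move=> b; do 2 apply: cvgMr; exact: continuous_digit_sum.
(* Writing each digit as [m - 1] times a boolean exhibits [A] as a continuous image of the Cantor
   space, hence as a compact set. *)
have AE : A = range fA.
  have cvg_fA (b : nat -> bool) :
      series (fun n => ((m - 1) * b n)%:R / m%:R ^+ n.+1 : R) @ \oo --> fA b.
    have -> : series (fun n => ((m - 1) * b n)%:R / m%:R ^+ n.+1) =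
        (fun n => c * series (fun n => (b n)%:R * q ^+ n) n).
      apply/funext => n; rewrite /series /= mulr_sumr; apply: eq_bigr => i _.
      by rewrite natrM -exprVn exprS /c -/q; ring.
    by apply: cvgMr; exact: cvg_digit_sum.
  apply/seteqP; split=> [a [i i01 ia]|_ [b _ <-]].
    have [b iE] : exists b : cantor_space, i = (fun n => (m - 1) * b n)%N.
      exists (fun n => i n != 0%N); apply/funext => n.
      case: (i01 n) => ->; first by rewrite muln0.
      by rewrite subn_eq0 leqNgt (leq_trans _ hm)// muln1.
    rewrite iE in ia; exists b => //.
    exact: (@cvg_unique _ (@Rhausdorff R) _ _ _ _ (cvg_fA b) ia).
  exists (fun n => ((m - 1) * b n)%N) => // n.
  by case: (b n); rewrite ?muln1 ?muln0; [right|left].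
(* Cancelling [c] leaves an equation between digit sums with digits in {-1, 0, 1}, the case [k = 0]
   of [double_digit_sum_eq0]. It yields both the injectivity of [fC] and the bound on
   intersections. *)
have fCfA (b b' a a' : cantor_space) : fC b - fC b' = fA a - fA a' -> b = b'.
  rewrite -!mulrBr => /(mulfI c0); rewrite -!digit_sumB// => H.
  have diff1 (u v : cantor_space) n : `|(u n)%:Z - (v n)%:Z| <= 1.
    by case: (u n); case: (v n).
  have/(_ _) bb' := double_digit_sum_eq0 R m (fun n => (b n)%:Z - (b' n)%:Z)
    (fun n => (a n)%:Z - (a' n)%:Z) 0 hm (diff1 _ _) (diff1 _ _) _.
  apply/funext => n; have : (b n)%:Z - (b' n)%:Z = 0.
    apply: bb'; rewrite mulr0 addr0.
    under eq_fun do rewrite intrB.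
    under [in RHS]eq_fun do rewrite intrB.
    exact: H.
  by case: (b n); case: (b' n).
have fC_inj : injective fC.
  by move=> b b' bb'; apply: (fCfA b b' b b); rewrite bb' !subrr.
(* Being compact, [A] is closed and so serves as its own Borel hull. *)
exists A, (range fC); split => //.
- apply: measurable_realfun.closed_measurable; rewrite AE.
  apply: compact_closed; first exact: Rhausdorff.
  apply: continuous_compact; last exact: cantor_space_compact.
  exact: continuous_subspaceT.
- exact: (compact_homeomorphic_copy cantor_space R fC cantor_space_compact
    (@Rhausdorff R) fCc fC_inj).
- move=> x; apply: is_subset1_card_le.
  (* The two points are [fC b + x = fA a] and [fC b' + x = fA a']; subtracting eliminates [x]. *)
  rewrite AE => _ _ [[_ [b _ <-] <-] [a _ Ha]] [[_ [b' _ <-] <-] [a' _ Ha']].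
  suff -> : b = b' by [].
  by apply: (fCfA b b' a a'); rewrite Ha Ha'; ring.
Qed.
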